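(* Let $\mathcal{X}$ be a topological space with Borel $\sigma$-algebra $\mathcal{B}$, and let $\{\mu_n\}_{n\in\mathbb{N}}$ be a sequence of probability measures on $\mathcal{B}$ that satisfies a large deviations principle with rate function $J\colon \mathcal{X}\to[0,\infty]$. Let $\phi\colon\mathcal{X}\to[-\infty,\infty]$ be a Borel measurable function and define $\phi_M=\phi\wedge M$ (pointwise minimum) for $M\in\mathbb{R}$. Assume that at least one of the following conditions is true: 1. $J$ is continuous; 2. the superlevel set $\phi^{-1}([w,\infty])$ is closed for every $w\in\mathbb{R}$ satisfying $w\ge\lim_{M\to\infty}\sup_{x\in\mathcal{X}}\left[\phi_M(x)-J(x)\right]$. Then $$\limsup_{n\to\infty}\frac1n\log\int_{\mathcal{X}} e^{n\phi(x)}\,\mu_n(\mathrm{d}x)\;\le\;\lim_{M\to\infty}\sup_{x\in\mathcal{X}}\left[\phi_M(x)-J(x)\right]$$ if and only if $$\lim_{M\to\infty}\limsup_{n\to\infty}\frac1n\log\int_{\mathcal{X}} e^{n\phi(x)}\,\mathbf{1}_{\{\phi(x)>M\}}\,\mu_n(\mathrm{d}x)\;\le\;\lim_{M\to\infty}\sup_{x\in\mathcal{X}}\left[\phi_M(x)-J(x)\right].$$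
   Context: The sequence $\{\mu_n\}_{n\in\mathbb{N}}$ (indexed by positive integers) of probability measures on the Borel $\sigma$-algebra of $\mathcal{X}$ satisfies a large deviations principle (LDP) with rate function $J$ if $J\colon\mathcal{X}\to[0,\infty]$ is lower semicontinuous, $$\limsup_{n\to\infty}\frac1n\log\mu_n(F)\le-\inf_{x\in F}J(x)\quad\text{for every closed } F\subset\mathcal{X},$$ and $$\liminf_{n\to\infty}\frac1n\log\mu_n(G)\ge-\inf_{x\in G}J(x)\quad\text{for every open } G\subset\mathcal{X}.$$ It is not assumed that $J$ has compact sublevel sets (i.e. $J$ need not be a good rate function). No separation or other assumptions are made on $\mathcal{X}$. Continuity of $J$ means continuity as a map into $[0,\infty]$ with its usual topology. Conventions: $\exp(-\infty)=0$, $\log(0)=-\infty$, $\exp(\infty)=\log(\infty)=\infty$, and $\infty\cdot 0=0$ in integrands. All quantities take values in the extended reals $[-\infty,\infty]$. Since $\phi_M(x)\le M<\infty$ and $J(x)\ge 0$, the difference $\phi_M(x)-J(x)\in[-\infty,\infty)$ is always well defined; its supremum over $x$ is nondecreasing in $M$, so its limit as $M\to\infty$ exists in $[-\infty,\infty]$. $\mathbf{1}_{\{\cdot\}}$ denotes the indicator function. *)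

(* Defs.v *)
From HB Require Import structures.
From mathcomp Require Import all_boot all_order all_algebra.
From mathcomp Require Import all_classical all_reals all_analysis measurable_realfun.

Set Implicit Arguments.
Unset Strict Implicit.
Unset Printing Implicit Defensive.

Import Order.TTheory GRing.Theory Num.Theory.
Import numFieldNormedType.Exports.

Local Open Scope classical_set_scope.
Local Open Scope ring_scope.
Local Open Scope ereal_scope.

(* The library's measurable types are pointed, whence [ptopologicalType] below;
   a space carrying a probability measure is nonempty, so no space is lost. *)
Notation borel X := (g_sigma_algebraType (@open X)).

(* A sequence (u_n) over n >= 1 is read off [u : nat -> _] at the indices n.+1;
   the value [u 0] is never used. *)
Section large_deviations.
Context {R : realType} {X : ptopologicalType}.
Implicit Types (mu : nat -> probability (borel X) R) (J phi : X -> \bar R).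

Definition log_rate (a : nat -> \bar R) (n : nat) : \bar R :=
  (n.+1%:R^-1)%:E * lne (a n.+1).

Definition satisfies_LDP mu J : Prop :=
  [/\ forall x, 0 <= J x,
      lower_semicontinuous J,
      forall F : set X, closed F ->
        limn_esup (log_rate (fun n => mu n F)) <= - ereal_inf [set J x | x in F] &
      forall G : set X, open G ->
        - ereal_inf [set J x | x in G] <= limn_einf (log_rate (fun n => mu n G))].

Definition truncation phi (M : R) (x : X) : \bar R := Order.min (phi x) M%:E.

Definition truncated_sup phi J : \bar R :=
  lim (ereal_sup [set truncation phi M x - J x | x in [set: X]] @[M --> +oo%R]).

Definition exp_integral mu phi (n : nat) : \bar R :=
  \int[mu n]_x expeR (n%:R%:E * phi x).

(* In [\bar R], +oo * 0 = 0. *)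
Definition exp_integral_above mu phi (M : R) (n : nat) : \bar R :=
  \int[mu n]_x
    (expeR (n%:R%:E * phi x) * (\1_[set y : X | (M%:E < phi y)%E] x)%:E).

End large_deviations.

(* Main.v *)
Require Import Defs.
From HB Require Import structures.
From mathcomp Require Import all_boot all_order all_algebra.
From mathcomp Require Import all_classical all_reals all_analysis measurable_realfun.
From mathcomp Require Import lra.

Set Implicit Arguments.
Unset Strict Implicit.
Unset Printing Implicit Defensive.

Import Order.TTheory GRing.Theory Num.Theory.
Import numFieldNormedType.Exports.

Local Open Scope classical_set_scope.
Local Open Scope ring_scope.
Local Open Scope ereal_scope.

(* Write L for [truncated_sup phi J].  Since phi /\ w <= J + L, the set
   {phi >= w} is contained in {J >= w - L}, and for w >= L either assumption
   provides a closed set between the two: {J >= w - L} when J is continuous,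
   {phi >= w} otherwise.  The upper bound of the LDP then gives
   mu_n {phi >= w} <= e^(n (L - w + o(1))).  So, for L + d < c and w >= L, the
   slab {w < phi <= w + d} contributes at most e^(n (w + d)) e^(n (c - w - d))
   = e^(n c) to the integral.  Finitely many slabs join c to a level M above
   which the tail condition controls the integral. *)

(** * Extended reals, limits superior and logarithmic rates *)

Section extended_reals.
Context {R : realType}.
Implicit Types (x y L : \bar R) (u v : nat -> \bar R) (c : R).

(** Comparison with real c above L lets one argument serve finite and infinite L. *)
Lemma le_ereal_dense x L :
  (forall c, L < c%:E -> x <= c%:E) -> x <= L.
Proof.
case: L => [l| |] h; [|by rewrite leey|].
  apply/lee_addgt0Pr => e e0; rewrite -EFinD; apply: h.
  by rewrite lte_fin ltrDl.
case: x h => [r| |] h //.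
- have := h (r - 1)%R (ltNyr _).
  by rewrite lee_fin => ?; exfalso; lra.
- by have := h 0%R (ltNyr _).
Qed.

Lemma ereal_gap L c : L < c%:E ->
  exists2 d : R, (0 < d)%R & L + d%:E < (c - d)%:E.
Proof.
case: L => [l| |] // lc.
  (* Any positive d below half the gap c - l works. *)
  exists ((c - l) / 4)%R; rewrite lte_fin in lc.
    by rewrite divr_gt0 // subr_gt0.
  by rewrite -EFinD lte_fin; lra.
by exists 1%R; rewrite ?addNye ?ltNyr.
Qed.

(** The preimage of a generating ray from r upwards is everything if r <= 0, and the ray from ln r
    upwards otherwise. *)
Lemma measurable_expeR : measurable_fun [set: \bar R] expeR.
Proof.
apply: (measurability _ (ErealGenCInfty.measurableE R)) => //.
move=> _ [_ [r ->] <-]; rewrite setTI.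
have [r0|r0] := leP r 0%R.
  rewrite [X in measurable X](_ : _ = setT) //.
  apply/seteqP; split=> // y _ /=; rewrite in_itv /= andbT.
  by apply: le_trans (expeR_ge0 y); rewrite lee_fin.
rewrite [X in measurable X](_ : _ = `[(ln r)%:E, +oo[%classic).
  exact: emeasurable_itv.
apply/seteqP; split=> y /=; rewrite !in_itv /= !andbT;
  by rewrite -[(ln r)%:E <= y]lee_expeR /= lnK.
Qed.

Lemma limn_esup_lt_near u x :
  limn_esup u < x -> \forall n \near \oo, u n < x.
Proof.
(* [limn_esup u] is an infimum, over eventual sets V, of suprema on V, so some V witnesses the
   strict bound. *)
move=> /ereal_inf_lt[_ [V nV <-] Vx]; apply: filterS nV => n Vn.
by apply: le_lt_trans Vx; apply: ereal_sup_ubound; exists n.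
Qed.

Lemma near_limn_esup_le u x :
  (\forall n \near \oo, u n <= x) -> limn_esup u <= x.
Proof.
move=> ux; apply: ge_ereal_inf; exists (ereal_sup (u @` [set n | u n <= x])).
  by exists [set n | u n <= x].
by apply: ge_ereal_sup => _ [n unx <-].
Qed.

Lemma le_limn_esup u v : (forall n, u n <= v n) -> limn_esup u <= limn_esup v.
Proof.
move=> uv; apply: le_ereal_dense => c /limn_esup_lt_near vc.
apply: near_limn_esup_le; apply: filterS vc => n /ltW.
exact: le_trans.
Qed.

(** [expeR] inverts [lne] on [0, +oo], the values 0 and +oo included. *)
Lemma log_rate_le (a : nat -> \bar R) c n : 0 <= a n.+1 ->
  (log_rate a n <= c%:E) = (a n.+1 <= expeR (n.+1%:R * c)%:E).
Proof.
move=> a0; rewrite /log_rate lee_pdivrMl // -EFinM -[LHS]lee_expeR lneK //.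
by rewrite in_itv /= a0 leey.
Qed.

Lemma le_log_rate (a b : nat -> \bar R) n : 0 <= a n.+1 ->
  a n.+1 <= b n.+1 -> log_rate a n <= log_rate b n.
Proof.
move=> a0 ab; rewrite /log_rate lee_pmul2l // lee_lne // in_itv /= leey andbT //.
exact: le_trans ab.
Qed.

End extended_reals.

(** * Superlevel sets of phi and their exponential decay *)

Section varadhan.
Context {R : realType} {X : ptopologicalType}.
Variables (mu : nat -> probability (borel X) R) (J phi : X -> \bar R).
Hypothesis LDP : satisfies_LDP mu J.
Hypothesis mphi : measurable_fun [set: borel X] phi.
Local Notation L := (truncated_sup phi J).

(** The supremum over x is nondecreasing in M, so its limit L is also the supremum over M. *)
Lemma truncation_sub_le (w : R) x : truncation phi w x - J x <= L.
Proof.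
rewrite /truncated_sup (cvg_lim _ (nondecreasing_cvge _)) //.
  apply: (@le_trans _ _ (ereal_sup [set truncation phi w y - J y | y in setT])).
    by apply: ereal_sup_ubound; exists x.
  by apply: ereal_sup_ubound; exists w.
move=> v w' vw; apply: ge_ereal_sup => _ [y _ <-].
apply: (@le_trans _ _ (truncation phi w' y - J y)); last first.
  by apply: ereal_sup_ubound; exists y.
by rewrite leeB // /truncation le_min !ge_min lexx /= lee_fin vw orbT.
Qed.

(** At x the truncation equals w, hence w - J x <= L; the hypothesis L <= w excludes L = +oo. *)
Lemma rate_ge_superlevel (w : R) x : L <= w%:E -> w%:E <= phi x ->
  w%:E - L <= J x.
Proof.
move=> Lw wphi; have := truncation_sub_le w x.
rewrite /truncation (min_idPr wphi).
case: (J x) => [j| |]; rewrite ?leey //.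
- by case: L Lw => [l| |] //= _; rewrite ?leNye // -!EFinB !lee_fin; lra.
- by case: L Lw.
Qed.

Hypothesis J_or_phi : continuous J \/
  (forall w : R, L <= w%:E -> closed (phi @^-1` `[w%:E, +oo])).

Lemma closed_between (w : R) : L <= w%:E ->
  exists F : set X, [/\ closed F, phi @^-1` `[w%:E, +oo] `<=` F &
    F `<=` [set x | w%:E - L <= J x]].
Proof.
move=> Lw; have sub x : (phi @^-1` `[w%:E, +oo]) x -> w%:E - L <= J x.
  by rewrite /= in_itv /= => /andP[wx _]; exact: rate_ge_superlevel.
case: J_or_phi => [cJ|/(_ w Lw) cphi]; last first.
  by exists (phi @^-1` `[w%:E, +oo]); split.
exists (J @^-1` [set y | w%:E - L <= y]); split => //.
by move/continuous_closedP: cJ; apply; exact: closed_ereal_le_ereal.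
Qed.

Lemma measurable_superlevel (w : R) :
  measurable (phi @^-1` `[w%:E, +oo] : set (borel X)).
Proof.
by rewrite -[X in measurable X]setTI; apply: mphi => //; exact: emeasurable_itv.
Qed.

(** On the closed set between, J >= w - L > c; the strict inequality turns the limsup bound into one
    for all large n. *)
Lemma superlevel_decay (w c : R) : L <= w%:E -> L + c%:E < w%:E ->
  \forall n \near \oo,
    mu n.+1 (phi @^-1` `[w%:E, +oo]) <= expeR (n.+1%:R * - c)%:E.
Proof.
move=> Lw cw; have [F [cF phiF FJ]] := closed_between Lw.
have [_ _ upper _] := LDP.
have : limn_esup (log_rate (fun n => mu n F)) < (- c)%:E.
  apply: le_lt_trans (upper _ cF) _; rewrite EFinN lteNl oppeK.
  apply: (@lt_le_trans _ _ (w%:E - L)).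
    by case: L cw => [l| |] //=; rewrite -?EFinD -?EFinB ?ltry // !lte_fin; lra.
  by apply/ereal_infP => _ [x /FJ ? <-].
move/limn_esup_lt_near; apply: filterS => n /ltW.
rewrite log_rate_le //; apply: le_trans.
apply: le_measure => //; rewrite inE; first exact: measurable_superlevel.
by rewrite -[F]setCK; apply: measurableC; apply: sub_sigma_algebra; exact/closed_openC.
Qed.

(** * Exponential integrals restricted to sets *)

Lemma measurable_exp n :
  measurable_fun [set: borel X] (fun x => expeR (n%:R%:E * phi x)).
Proof.
by apply: measurableT_comp; [exact: measurable_expeR|exact: measurable_funeM].
Qed.

Lemma measurable_exp_indic n (A : set (borel X)) : measurable A ->
  measurable_fun [set: borel X]
    (fun x => expeR (n%:R%:E * phi x) * (\1_A x)%:E).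
Proof.
move=> mA; apply: emeasurable_funM; first exact: measurable_exp.
by apply/measurable_EFinP; exact: measurable_indic.
Qed.

Lemma measurable_above (w : R) : measurable ([set y | w%:E < phi y] : set (borel X)).
Proof.
by rewrite -[X in measurable X]setTI; exact: emeasurable_fun_o_infty.
Qed.

Lemma exp_indic_ge0 n (A : set X) x : 0 <= expeR (n%:R%:E * phi x) * (\1_A x)%:E.
Proof. by rewrite mule_ge0 ?expeR_ge0 // lee_fin. Qed.

Lemma exp_integral_ge0 n : 0 <= exp_integral mu phi n.
Proof. by apply: integral_ge0 => x _; exact: expeR_ge0. Qed.

Lemma exp_integral_above_ge0 (w : R) n : 0 <= exp_integral_above mu phi w n.
Proof. by apply: integral_ge0 => x _; exact: exp_indic_ge0. Qed.

Lemma le_exp_indic n (A B : set (borel X)) : measurable A -> measurable B ->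
  A `<=` B ->
  \int[mu n]_x (expeR (n%:R%:E * phi x) * (\1_A x)%:E) <=
  \int[mu n]_x (expeR (n%:R%:E * phi x) * (\1_B x)%:E).
Proof.
move=> mA mB AB; apply: ge0_le_integral => //.
- by move=> x _; exact: exp_indic_ge0.
- exact: measurable_exp_indic.
- exact: measurable_exp_indic.
- move=> x _; rewrite lee_pmul ?expeR_ge0 ?lee_fin // !indicE ler_nat.
  by have [|//] := boolP (x \in A); rewrite inE => /AB Bx; rewrite mem_set.
Qed.

(** Puts the full integral in the form with an indicator, to which comparison and splitting
    apply. *)
Lemma exp_integralE n : exp_integral mu phi n =
  \int[mu n]_x (expeR (n%:R%:E * phi x) * (\1_[set: X] x)%:E).
Proof. by apply: eq_integral => x _; rewrite indicT mule1. Qed.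

Lemma exp_integral_above_le (w : R) n :
  exp_integral_above mu phi w n <= exp_integral mu phi n.
Proof.
by rewrite exp_integralE; apply: le_exp_indic => //; exact: measurable_above.
Qed.

Lemma exp_integral_above_anti (v w : R) n : (v <= w)%R ->
  exp_integral_above mu phi w n <= exp_integral_above mu phi v n.
Proof.
move=> vw; apply: le_exp_indic; [exact: measurable_above..|].
by move=> x /=; apply: le_lt_trans; rewrite lee_fin.
Qed.

(** Tails shrink as M grows, so the limit is an infimum, and a strict upper bound on it already
    holds at some real M. *)
Lemma tail_rateE :
  lim (limn_esup (log_rate (exp_integral_above mu phi M)) @[M --> +oo%R]) =
  ereal_inf (range (fun M => limn_esup (log_rate (exp_integral_above mu phi M)))).
Proof.
have anti : {homo (fun M => limn_esup (log_rate (exp_integral_above mu phi M))) :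
    v w / (v <= w)%R >-> w <= v}.
  move=> v w vw; apply: le_limn_esup => n; apply: le_log_rate.
    exact: exp_integral_above_ge0.
  exact: exp_integral_above_anti.
exact: cvg_lim (nonincreasing_cvge anti).
Qed.

(** Where phi > w the first integrand dominates; elsewhere e^(n phi) <= e^(n w), integrated over
    A. *)
Lemma exp_integral_split (A : set (borel X)) (w : R) n : measurable A ->
  \int[mu n]_x (expeR (n%:R%:E * phi x) * (\1_A x)%:E) <=
  exp_integral_above mu phi w n + expeR (n%:R * w)%:E * mu n A.
Proof.
move=> mA.
have mw := measurable_exp_indic n (measurable_above w).
have mI : measurable_fun [set: borel X] (fun x => (\1_A x : R)%:E).
  by apply/measurable_EFinP; exact: measurable_indic.
have -> : expeR (n%:R * w)%:E * mu n A =
    \int[mu n]_x (expeR (n%:R * w)%:E * (\1_A x)%:E).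
  by rewrite ge0_integralZl_EFin ?integral_indic ?setIT ?expR_ge0.
rewrite -ge0_integralD //; last 3 first.
- by move=> x _; exact: exp_indic_ge0.
- by move=> x _; rewrite mule_ge0 // ?expeR_ge0 ?lee_fin.
- exact: measurable_funeM.
apply: ge0_le_integral => //.
- by move=> x _; exact: exp_indic_ge0.
- exact: measurable_exp_indic.
- by apply: emeasurable_funD => //; exact: measurable_funeM.
- move=> x _; have [phix|phix] := ltP w%:E (phi x).
    have -> : \1_[set y | (w%:E < phi y)%E] x = 1%R :> R by rewrite indicE mem_set.
    rewrite mule1.
    rewrite -[leLHS]adde0 leeD //; last first.
      by rewrite mule_ge0 // ?expeR_ge0 ?lee_fin.
    by rewrite -[leRHS]mule1 lee_pmul ?expeR_ge0 ?lee_fin.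
  rewrite -[leLHS]add0e leeD ?exp_indic_ge0 //.
  rewrite lee_pmul ?expeR_ge0 ?lee_fin // lee_expeR EFinM.
  by rewrite lee_wpmul2l // lee_fin.
Qed.

(** * Descent through the slabs and the final bound *)

(* The constant K absorbs the number of slabs; it disappears after taking
   logarithms and dividing by n. *)
Definition controlled (c w : R) := exists2 K : R, (0 <= K)%R &
  \forall n \near \oo,
    exp_integral_above mu phi w n.+1 <= (K * expR (n.+1%:R * c))%:E.

(** Splitting {phi >= w} at w + d leaves the controlled part above and one slab, which adds 1 to
    K. *)
Lemma controlled_step (c d w : R) : L <= w%:E -> L + d%:E < c%:E ->
  controlled c (w + d) -> controlled c w.
Proof.
move=> Lw Ldc [K K0 wd]; exists (K + 1)%R; first by rewrite addr_ge0.
(* The decay rate w + d - c is chosen so that e^(n (w + d)) times the decay is e^(n c). *)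
have decay : L + (w + d - c)%:E < w%:E.
  by case: L Ldc => [l| |] //; rewrite -?EFinD ?ltNyr // !lte_fin; lra.
have := superlevel_decay Lw decay; apply: filterS2 wd => n wd wn.
have above_sub : [set y | w%:E < phi y] `<=` phi @^-1` `[w%:E, +oo].
  by move=> x /= /ltW wx; rewrite in_itv /= wx leey.
have mw := measurable_superlevel w.
apply: (le_trans (le_exp_indic _ (measurable_above w) mw above_sub)).
apply: (le_trans (exp_integral_split (w + d) n.+1 mw)).
rewrite mulrDl mul1r EFinD leeD //.
apply: (@le_trans _ _ (expeR (n.+1%:R * (w + d))%:E * expeR (n.+1%:R * - (w + d - c))%:E)).
  by rewrite lee_wpmul2l ?expeR_ge0.
by rewrite -expeRD -EFinD -mulrDr (_ : w + d - (w + d - c) = c)%R //; lra.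
Qed.

Lemma exp_integral_le_rate (c : R) : L < c%:E ->
  lim (limn_esup (log_rate (exp_integral_above mu phi M)) @[M --> +oo%R]) <= L ->
  \forall n \near \oo, exp_integral mu phi n.+1 <= expeR (n.+1%:R * c)%:E.
Proof.
(* d is both slab width and slack: working at the rate c - d leaves a factor e^(n d) to absorb
   constants. *)
move=> Lc tail; have [d d0 Ldc] := ereal_gap Lc.
have Lcd : L < (c - d)%:E.
  by case: L Ldc => [l| |] //; rewrite -?EFinD ?ltNyr // !lte_fin; lra.
(* The tail condition supplies a level M with constant 1. *)
have [M Mc] : exists M : R, controlled (c - d) M.
  move: tail; rewrite tail_rateE => tail.
  have /ereal_inf_lt[_ [M _ <-] Mc] := le_lt_trans tail Lcd.
  exists M, 1%R => //; move/limn_esup_lt_near: Mc; apply: filterS => n /ltW.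
  by rewrite log_rate_le ?exp_integral_above_ge0 // mul1r.
have [K K0 cK] : controlled (c - d) (c - d).
  (* k slabs of width d climb from c - d to at least M. *)
  have [k Mk] : exists k : nat, (M <= c - d + k%:R * d)%R.
    exists (Num.bound (`|M - (c - d)| / d)%R).
    rewrite -lerBlDl (le_trans (ler_norm _)) // -ler_pdivrMr // ltW //.
    by rewrite archi_boundP // divr_ge0 // ltW.
  have : controlled (c - d) (c - d + k%:R * d).
    case: Mc => K K0 KM; exists K => //; apply: filterS KM => n.
    by apply: le_trans; exact: exp_integral_above_anti.
  (* Each step removes the top slab; the levels c - d + k d all stay above L, as [controlled_step]
     requires. *)
  elim: k {Mk} => [|k IH]; first by rewrite mul0r addr0.
  rewrite -natr1 mulrDl mul1r addrA => /controlled_step H; apply/IH/H => //.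
  by apply: (le_trans (ltW Lcd)); rewrite lee_fin lerDl mulr_ge0 // ltW.
near=> n.
have : exp_integral mu phi n.+1 <= ((K + 1) * expR (n.+1%:R * (c - d)))%:E.
  (* Below the level c - d the integrand is at most e^(n (c - d)), and the total mass is 1. *)
  have := exp_integral_split (c - d) n.+1 (@measurableT _ (borel X)).
  rewrite -exp_integralE probability_setT mule1 => /le_trans; apply.
  rewrite mulrDl mul1r EFinD leeD //.
  by near: n.
move=> /le_trans; apply; rewrite lee_fin.
rewrite (_ : n.+1%:R * c = n.+1%:R * d + n.+1%:R * (c - d))%R; last by lra.
(* With m = n + 1, e^(m d) >= 1 + m d >= 1 + K once n >= K / d. *)
rewrite expRD ler_pM2r ?expR_gt0 //; apply: le_trans (expR_ge1Dx _).
rewrite addrC lerD2l -ler_pdivrMr // (@le_trans _ _ n%:R%R) ?ler_nat //.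
by near: n; exact: nbhs_infty_ger.
Unshelve. all: by end_near. Qed.

End varadhan.

Theorem lemma2p2 (R : realType) (X : ptopologicalType)
    (mu : nat -> probability (borel X) R) (J : X -> \bar R)
    (phi : X -> \bar R) :
  satisfies_LDP mu J ->
  measurable_fun [set: borel X] phi ->
  continuous J \/
    (forall w : R, truncated_sup phi J <= w%:E ->
       closed (phi @^-1` `[w%:E, +oo])) ->
  limn_esup (log_rate (exp_integral mu phi)) <= truncated_sup phi J
  <->
  lim (limn_esup (log_rate (exp_integral_above mu phi M)) @[M --> +oo%R])
    <= truncated_sup phi J.
Proof.
move=> LDP mphi J_or_phi; split=> [full|tail].
  apply: le_trans full; rewrite tail_rateE //.
  (* One level bounds the infimum; at M = 0 the tail is at most the full integral. *)
  apply: ge_ereal_inf; exists (limn_esup (log_rate (exp_integral_above mu phi 0))).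
    by exists 0%R.
  apply: le_limn_esup => n; apply: le_log_rate.
    exact: exp_integral_above_ge0.
  exact: exp_integral_above_le.
apply: le_ereal_dense => c Lc; apply: near_limn_esup_le.
apply: filterS (exp_integral_le_rate LDP mphi J_or_phi Lc tail) => n.
by rewrite log_rate_le // exp_integral_ge0.
Qed.
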